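(* Let $r\in\mathbb Z_{>0}$ and $\tau,\lambda\in\mathbb R_{>0}$ with $\sigma:=\tau-r\lambda>0$, and let $\Delta\subset\mathbb R^2$ be the trapezium with vertices $(0,0)$, $(0,\lambda)$, $(\tau,0)$, $(\sigma,\lambda)$. Let $\mathbf b=(b_1,b_2)\in\mathbb R^2$. Then $(\Delta,\mathbf b)$ is a mass linear pair if and only if $rb_1=2b_2$. Moreover, in this case, writing $\langle\mathrm{Cm}(\Delta(k)),\mathbf b\rangle=\sum_{j=1}^4R_jk_j+C$ on $\mathcal C_\Delta$ with $R_j,C$ constant, one has $\sum_{j=1}^4R_j=0$.
   Context: The trapezium $\Delta$ has outward conormals $\mathbf n_1=(-1,0)$, $\mathbf n_2=(0,-1)$, $\mathbf n_3=(0,1)$, $\mathbf n_4=(1,r)$. For $k\in\mathbb R^4$ put $\Delta(k)=\bigcap_{j=1}^4\{x\in\mathbb R^2:\langle x,\mathbf n_j\rangle\le k_j\}$, with facets $F_j(k)$ contained in $\langle x,\mathbf n_j\rangle=k_j$; thus $\Delta=\Delta(0,0,\lambda,\tau)$. The chamber $\mathcal C_\Delta$ is the set of $k\in\mathbb R^4$ such that $\Delta(k)$ is analogous to $\Delta$: for every $J\subset\{1,2,3,4\}$ the facets $F_j(k)$, $j\in J$, of $\Delta(k)$ have nonempty common intersection iff the corresponding facets of $\Delta$ do. $\mathrm{Cm}(\Delta(k))$ is the center of mass of $\Delta(k)$. The pair $(\Delta,\mathbf b)$ is mass linear if there are constants $R_j,C\in\mathbb R$ with $\langle\mathrm{Cm}(\Delta(k)),\mathbf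 b\rangle=\sum_jR_jk_j+C$ for all $k\in\mathcal C_\Delta$. *)

(* Defs.v *)
From HB Require Import structures.
From mathcomp Require Import all_boot all_order all_algebra.
From mathcomp Require Import ring lra.
From mathcomp Require Import all_classical all_reals all_analysis.

Set Implicit Arguments.
Unset Strict Implicit.
Unset Printing Implicit Defensive.

Import Order.TTheory GRing.Theory Num.Theory.
Import numFieldNormedType.Exports.

Local Open Scope classical_set_scope.
Local Open Scope ring_scope.

Section Polygons.
Context {R : realType}.

Definition dotp (x y : R * R) : R := x.1 * y.1 + x.2 * y.2.

(* The Borel plane: measurableTypeR R is R itself, in the form on which
   lebesgue_measure is declared, so that the integrals below are taken over
   exactly the measurable structure carrying the product measure. *)
Local Notation plane := (measurableTypeR R * measurableTypeR R)%type.

Definition area_measure : set plane -> \bar R :=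
  (@lebesgue_measure R \x @lebesgue_measure R)%E.

(* Meaningful when P is bounded, measurable and of positive area. *)
Definition Cm (P : set plane) : R * R :=
  let a := fine (area_measure P) in
  ((\int[area_measure]_(x in P) x.1) / a,
   (\int[area_measure]_(x in P) x.2) / a).

Section Family.
Context {N : nat} (n : 'I_N -> R * R).

Definition polygon (k : 'rV[R]_N) : set (R * R) :=
  \bigcap_(j in [set: 'I_N]) [set x | dotp x (n j) <= k 0 j].

Definition facet (k : 'rV[R]_N) (j : 'I_N) : set (R * R) :=
  polygon k `&` [set x | dotp x (n j) = k 0 j].

(* The condition at J = set0 is vacuous: both empty intersections are the
   whole plane. *)
Definition analogous (k k' : 'rV[R]_N) : Prop :=
  forall J : set 'I_N,
    \bigcap_(j in J) facet k j !=set0 <-> \bigcap_(j in J) facet k' j !=set0.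

Definition chamber (k0 : 'rV[R]_N) : set 'rV[R]_N :=
  [set k | analogous k k0].

Definition Cm_affine (k0 : 'rV[R]_N) (b : R * R) (c : 'I_N -> R) (C : R) :=
  forall k, chamber k0 k ->
    dotp (Cm (polygon k)) b = \sum_j c j * k 0 j + C.

Definition mass_linear (k0 : 'rV[R]_N) (b : R * R) : Prop :=
  exists (c : 'I_N -> R) (C : R), Cm_affine k0 b c C.

End Family.

Definition conv_hull {m : nat} (v : m.-tuple (R * R)) : set (R * R) :=
  [set x | exists t : 'I_m -> R,
    [/\ forall i, 0 <= t i, \sum_i t i = 1 & x = \sum_i t i *: tnth v i]].

Definition trap_conormal (r : int) : 'I_4 -> R * R :=
  tnth [tuple (-1, 0); (0, -1); (0, 1); (1, r%:~R)].

Definition trap_support (lambda tau : R) : 'rV[R]_4 :=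
  \row_j tnth [tuple 0; 0; lambda; tau] j.

(* The polygon with these conormals and support numbers is the trapezium with
   the expected vertices. *)
Lemma trapezium_conv_hull (r : int) (lambda tau : R) :
  0 < r -> 0 < lambda -> 0 < tau -> 0 < tau - r%:~R * lambda ->
  polygon (trap_conormal r) (trap_support lambda tau) =
  conv_hull [tuple (0, 0); (0, lambda); (tau, 0);
                   (tau - r%:~R * lambda, lambda)].
Proof.
rewrite -(ltr0z R) /trap_conormal; set q : R := r%:~R.
move=> q0 l0 t0 s0; apply/seteqP; split=> -[x y].
- move=> h.
  have := h ord0 I; have := h (inord 1) I.
  have := h (inord 2) I; have := h (inord 3) I.
  rewrite /dotp /= !mxE !(tnth_nth 0) /= !inordK //= => h4 h3 h2 h1.
  have d0 : 0 < tau - q * y by nra.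
  pose s := y / lambda; pose u := x / (tau - q * y).
  have ys : y = s * lambda by rewrite /s; field; rewrite gt_eqF.
  have xu : x = u * (tau - q * y) by rewrite /u; field; rewrite gt_eqF.
  have s1 : 0 <= s <= 1.
    by rewrite /s divr_ge0 ?ler_pdivrMr //=; [lra | lra | exact: ltW].
  have u1 : 0 <= u <= 1.
    by rewrite /u divr_ge0 ?ler_pdivrMr //=; [lra | lra | exact: ltW].
  clearbody s u.
  exists (tnth [tuple (1 - s) * (1 - u); s * (1 - u); (1 - s) * u; s * u]).
  split.
  + case/andP: s1 => ? ?; case/andP: u1 => ? ?.
    case=> -[|[|[|[|//]]]] i4; rewrite (tnth_nth 0) /=;
      by apply: mulr_ge0; rewrite ?subr_ge0.
  + rewrite !big_ord_recl big_ord0 !(tnth_nth 0) /=; ring.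
  + rewrite !big_ord_recl big_ord0 !(tnth_nth 0) /=.
    apply/eqP; rewrite xpair_eqE /=; apply/andP; split; apply/eqP.
    * by rewrite xu ys /GRing.scale /=; ring.
    * by rewrite ys /GRing.scale /=; ring.
- move=> [t [t_ge0]]; rewrite !big_ord_recl !big_ord0 !(tnth_nth 0) /=.
  set a1 := t _; set a2 := t _; set a3 := t _; set a4 := t _ => sum1 [-> ->].
  have [p1 p2 p3 p4] : [/\ 0 <= a1, 0 <= a2, 0 <= a3 & 0 <= a4].
    by split; exact: t_ge0.
  clearbody a1 a2 a3 a4.
  case=> -[|[|[|[|//]]]] i4 _; rewrite /dotp /= mxE !(tnth_nth 0) /=;
    rewrite /GRing.scale /=; nra.
Qed.

End Polygons.

(* Main.v *)
Require Import Defs.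
From HB Require Import structures.
From mathcomp Require Import all_boot all_order all_algebra.
From mathcomp Require Import ring lra.
From mathcomp Require Import all_classical all_reals all_analysis.
From mathcomp Require Import measurable_realfun.

(* Write h = k_3 + k_2 for the height of Delta(k), s = k_4 - r k_3 + k_1 for the
   width of its top edge and B = s + r h for that of its bottom edge.  The
   chamber is the open cone h > 0, s > 0, and there
     <Cm, b> = b_1 ((B^2 + B s + s^2) / (3 (B + s)) - k_1)
               + b_2 (h (B + 2 s) / (3 (B + s)) - k_2).
   If r b_1 = 2 b_2 the numerators add up to a multiple of B + s, and the
   expression collapses to b_1 (k_4 - k_1) / 2, whose coefficients sum to 0; it
   determines any affine expression on an open cone.  Otherwise the term
   s^2 / (B + s) survives, and it is not affine in B. *)

Import Order.TTheory GRing.Theory Num.Theory.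
Import numFieldNormedType.Exports.
Local Open Scope classical_set_scope.
Local Open Scope ring_scope.

(** * One-variable integration, measurability and explicit inequalities *)

(** The fundamental theorem of calculus with the cubic primitive [F]. It serves both integrations in
    the Fubini computation of [trap_integral]. *)
Lemma integral_quadratic {R : realType} (a b p0 p1 p2 : R) : a < b ->
  (\int[@lebesgue_measure R]_(x in `[a, b]) (p0 + p1 * x + p2 * x ^+ 2)%:E =
   (p0 * (b - a) + p1 / 2 * (b ^+ 2 - a ^+ 2)
    + p2 / 3 * (b ^+ 3 - a ^+ 3))%:E)%E.
Proof.
move=> ab.
pose F (x : R) : R := p0 * x + p1 / 2 * x ^+ 2 + p2 / 3 * x ^+ 3.
have dF (x : R) : is_derive x 1 F (p0 + p1 * x + p2 * x ^+ 2).
  by rewrite /F; apply: is_derive_eq; rewrite /GRing.scale /=; field.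
have cF : continuous F.
  by move=> y; apply/differentiable_continuous/derivable1_diffP.
pose f (x : R) := p0 + p1 * x + p2 * x ^+ 2.
transitivity ((F b)%:E - (F a)%:E)%E; last first.
  by rewrite -EFinB /F; congr EFin; ring.
apply: (@continuous_FTC2 R f F) => //.
- apply: continuous_subspaceT => x.
  apply: cvgD; last by apply: cvgM; [exact: cvg_cst | exact: exprn_continuous].
  apply: cvgD; first exact: cvg_cst.
  by apply: cvgM; [exact: cvg_cst | exact: cvg_id].
- split=> [x _||].
  + exact: ex_derive.
  + by apply: cvg_at_right_filter; exact: cF.
  + by apply: cvg_at_left_filter; exact: cF.
- by move=> x _; rewrite derive1E; apply: derive_val.
Qed.

Lemma measurable_polygon {R : realType} {N : nat} (n : 'I_N -> R * R)
    (k : 'rV[R]_N) :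
  measurable (polygon n k : set (measurableTypeR R * measurableTypeR R)).
Proof.
apply: fin_bigcap_measurable => [|j _]; first exact: finite_finset.
pose f (x : measurableTypeR R * measurableTypeR R) : measurableTypeR R :=
  dotp x (n j).
rewrite [X in measurable X](_ : _ = setT `&` f @^-1` `]-oo, k 0 j]); last first.
  by rewrite setTI; apply/seteqP; split=> x /=; rewrite in_itv.
have mf : measurable_fun setT f.
  by apply: measurable_funD; apply: measurable_funM.
by apply: mf.
Qed.

Lemma ord4P (j : 'I_4) :
  [\/ j = ord0, j = inord 1, j = inord 2 | j = inord 3].
Proof.
case: j => -[|[|[|[|//]]]] j4;
  [apply/Or41 | apply/Or42 | apply/Or43 | apply/Or44];
  by apply/val_inj; rewrite /= ?inordK.
Qed.

Lemma trap_polygonP {R : realType} (r : int) (k : 'rV[R]_4) (x y : R) :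
  polygon (trap_conormal r) k (x, y) <->
  [/\ - k 0 ord0 <= x, - k 0 (inord 1) <= y, y <= k 0 (inord 2)
    & x + r%:~R * y <= k 0 (inord 3)].
Proof.
rewrite /trap_conormal; split.
- move=> h; have := h ord0 I; have := h (inord 1) I.
  have := h (inord 2) I; have := h (inord 3) I.
  rewrite /dotp /= !(tnth_nth 0) /= !inordK //= => h4 h3 h2 h1.
  by split; lra.
- case=> h1 h2 h3 h4 j _.
  have [|||] := ord4P j.
  all: move=> ->; rewrite /dotp ?(tnth_nth 0) /= ?inordK //=; lra.
Qed.

(** * Area and first moments of the trapezium *)

Section Trapezium.
Context {R : realType} (r : int) (k : 'rV[R]_4).
Hypothesis r0 : 0 < r.
Local Notation q := (r%:~R : R).
Local Notation k1 := (k 0 ord0).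
Local Notation k2 := (k 0 (inord 1)).
Local Notation k3 := (k 0 (inord 2)).
Local Notation k4 := (k 0 (inord 3)).
Let h := k3 + k2.
Let s := k4 - q * k3 + k1.
Hypotheses (h0 : 0 < h) (s0 : 0 < s).
Let P := polygon (trap_conormal r) k.
Local Notation mu := (@lebesgue_measure R).
Local Notation plane := (measurableTypeR R * measurableTypeR R)%type.

Let q0 : 0 < q. Proof. by rewrite ltr0z. Qed.

(** The right end [k4 + q * k2] is the abscissa of the lower right vertex. The box gives both finite
    area and bounded integrands. *)
Lemma trap_subset_box :
  P `<=` `[- k1, k4 + q * k2] `*` `[- k2, k3].
Proof.
move=> [x y] /trap_polygonP[h1 h2 h3 h4]; split => /=; rewrite in_itv /=.
  have : 0 <= q * (y + k2) by rewrite mulr_ge0 ?(ltW q0) // -lerBlDr sub0r.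
  by rewrite mulrDr => ?; apply/andP; split=> //; lra.
by apply/andP.
Qed.

Lemma trap_area_fin : (area_measure (P : set plane) < +oo)%E.
Proof.
have mX (a b : R) : measurable (`[a, b] : set (measurableTypeR R)).
  exact: measurable_itv.
apply: (@le_lt_trans _ _ (area_measure
  ((`[- k1, k4 + q * k2] `*` `[- k2, k3]) : set plane))).
  apply: le_measure; rewrite ?inE.
  - exact: measurable_polygon.
  - by apply: measurableX; exact: mX.
  - exact: trap_subset_box.
rewrite /area_measure product_measure1E; [|exact: mX..].
have mu_itv (a b : R) : exists l : R, mu `[a, b] = l%:E.
  rewrite lebesgue_measure_itv /=; case: ifP => _; last by exists 0.
  by exists (b - a).
have [l1 E1] := mu_itv (- k1) (k4 + q * k2).
have [l2 E2] := mu_itv (- k2) k3.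
rewrite [X in (X * _)%E]E1 [X in (_ * X)%E]E2 -EFinM ltry //.
Qed.

Lemma trap_integrable (u v w : R) :
  integrable (area_measure : {measure set plane -> \bar R}) P
    (fun z : plane => (u + v * z.1 + w * z.2)%:E).
Proof.
apply: (@measurable_bounded_integrable _ plane R _
  (fun z : plane => u + v * z.1 + w * z.2)).
- exact: measurable_polygon.
- exact: trap_area_fin.
- apply: measurable_funTS.
  by apply: measurable_funD; [apply: measurable_funD|];
    do ?apply: measurable_funM.
- exists (`|u| + `|v| * (`|k1| + `|k4 + q * k2|) + `|w| * (`|k2| + `|k3|)).
  split.
    by rewrite num_real.
  move=> M MM [x y] /trap_subset_box[/=].
  rewrite !in_itv /= => /andP[x1 x2] /andP[y1 y2].
  apply/ltW/(le_lt_trans _ MM).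
  have xb : `|x| <= `|k1| + `|k4 + q * k2|.
    rewrite ler_norml; apply/andP.
    by have := ler_norm k1; have := ler_norm (k4 + q * k2);
      have := normr_ge0 k1; have := normr_ge0 (k4 + q * k2); split; lra.
  have yb : `|y| <= `|k2| + `|k3|.
    by rewrite ler_norml; apply/andP; have := ler_norm k2; have := ler_norm k3;
      have := normr_ge0 k2; have := normr_ge0 k3; split; lra.
  rewrite !(le_trans (ler_normD _ _))// lerD//;
    last by rewrite normrM ler_wpM2l.
  by rewrite (le_trans (ler_normD _ _))// lerD// normrM ler_wpM2l.
Qed.

(** An integrand with free coefficients yields the area [A] and both first moments at once. Fubini
    is applied with [x] innermost, since each horizontal slice is a single interval. *)
Lemma trap_integral (u v w : R) :
  (\int[area_measure]_(z in (P : set plane)) (u + v * z.1 + w * z.2)%:E =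
   (let B := s + q * h in let A := h * (B + s) / 2 in
    u * A + v * (- k1 * A + h * (B ^+ 2 + B * s + s ^+ 2) / 6)
          + w * (- k2 * A + h ^+ 2 * (B + 2 * s) / 6))%:E)%E.
Proof.
have mP : measurable (P : set plane) by exact: measurable_polygon.
pose e := k4 + k1.
(* This quadratic in [y] is the integral of [u + v * x + w * y] over the slice from [- k1] to
   [k4 - q * y]. *)
transitivity (\int[mu]_(y in `[(- k2)%R, k3])
   ((e * u + v / 2 * (k4 ^+ 2 - k1 ^+ 2))
    + (e * w - q * u - v * k4 * q) * y
    + (v / 2 * q ^+ 2 - q * w) * y ^+ 2)%:E)%E; last first.
  rewrite integral_quadratic; last by rewrite -subr_gt0 opprK.
  by congr EFin; rewrite /= /s /h /e; field.
rewrite integral_mkcond /area_measure -integral21_prod_meas1; last first.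
  apply: iffLR (trap_integrable u v w).
  exact: integrable_mkcond.
rewrite [RHS]integral_mkcond; apply: eq_integral => y _.
rewrite /fubini_G [RHS]patchE.
case: ifPn => [|yk].
- rewrite inE /= in_itv /= => /andP[y1 y2].
  (* The slices shorten as [y] grows, and the top one has length [s > 0]. *)
  have ke : - k1 < k4 - q * y.
    have : q * y <= q * k3 by rewrite ler_pM2l.
    by move: s0; rewrite /s; lra.
  transitivity (\int[mu]_(x in `[(- k1)%R, (k4 - q * y)%R])
     ((u + w * y) + v * x + 0 * x ^+ 2)%:E)%E; last first.
    by rewrite integral_quadratic // /e; congr EFin; field.
  rewrite [RHS]integral_mkcond; apply: eq_integral => x _.
  rewrite !patchE.
  have -> : ((x, y) \in (P : set plane)) = (x \in `[- k1, k4 - q * y]%classic).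
    apply/idP/idP; rewrite !inE /= in_itv /=.
      by move=> /trap_polygonP[? ? ? ?]; apply/andP; split; lra.
    by move=> /andP[? ?]; apply/trap_polygonP; split; lra.
  by case: ifP => // _; congr EFin; rewrite /=; ring.
(* Outside the range of heights the slice is empty. *)
- apply: integral0_eq => x _.
  rewrite patchE ifN //; apply: contra yk; rewrite !inE /= in_itv /=.
  by move=> /trap_polygonP[? ? ? ?]; apply/andP; split; lra.
Qed.

Lemma trap_Cm (b : R * R) :
  dotp (Cm (P : set plane)) b =
  (let B := s + q * h in
   b.1 * ((B ^+ 2 + B * s + s ^+ 2) / (3 * (B + s)) - k1)
   + b.2 * (h * (B + 2 * s) / (3 * (B + s)) - k2)).
Proof.
rewrite /dotp /Cm /Rintegral.
have -> : area_measure (P : set plane) =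
   (\int[area_measure]_(z in (P : set plane)) (1 + 0 * z.1 + 0 * z.2)%:E)%E.
  under eq_integral do rewrite !mul0r !addr0.
  rewrite integral_cst ?mul1e //; exact: measurable_polygon.
have -> : (\int[area_measure]_(x in (P : set plane)) (x.1)%:E)%E =
   (\int[area_measure]_(z in (P : set plane)) (0 + 1 * z.1 + 0 * z.2)%:E)%E.
  by apply: eq_integral => z _; congr EFin; ring.
have -> : (\int[area_measure]_(x in (P : set plane)) (x.2)%:E)%E =
   (\int[area_measure]_(z in (P : set plane)) (0 + 0 * z.1 + 1 * z.2)%:E)%E.
  by apply: eq_integral => z _; congr EFin; ring.
rewrite !trap_integral /=.
field.
have qh : 0 < q * h by rewrite mulr_gt0.
by rewrite (gt_eqF h0) gt_eqF ?(addr_gt0 (addr_gt0 s0 qh) s0).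
Qed.

End Trapezium.

(** * Facet incidences and the chamber *)

(** Only opposite sides are disjoint: bottom and top are parallel and distinct, and the lines of the
    left and slanted sides cross above the top edge because [s > 0]. *)
Lemma trap_facets_meet {R : realType} (r : int) (k : 'rV[R]_4) (J : set 'I_4) :
  0 < r -> 0 < k 0 (inord 2) + k 0 (inord 1) ->
  0 < k 0 (inord 3) - r%:~R * k 0 (inord 2) + k 0 ord0 ->
  \bigcap_(j in J) facet (trap_conormal r) k j !=set0 <->
  ~ (J (inord 1) /\ J (inord 2)) /\ ~ (J ord0 /\ J (inord 3)).
Proof.
move=> r0 h0 s0; have q0 : 0 < r%:~R :> R by rewrite ltr0z.
split=> [[[x y] xy]|[J12 J03]].
- split=> -[/xy [_ /= e1] /xy [/trap_polygonP[? ? ? ?]  /=]];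
  move: e1; rewrite /dotp /trap_conormal !(tnth_nth 0) /= ?inordK //=; nra.
(* The witness is a vertex: top if [J] asks for the top side, otherwise bottom; then right if [J]
   asks for the slanted side, otherwise left. *)
- pose y := if `[< J (inord 2) >] then k 0 (inord 2) else - k 0 (inord 1).
  pose x :=
    if `[< J (inord 3) >] then k 0 (inord 3) - r%:~R * y else - k 0 ord0.
  have yP : - k 0 (inord 1) <= y <= k 0 (inord 2).
    by rewrite /y; case: ifP => _; apply/andP; split; lra.
  have qy : r%:~R * y <= r%:~R * k 0 (inord 2).
    by rewrite ler_pM2l //; case/andP: yP.
  have xP : - k 0 ord0 <= x <= k 0 (inord 3) - r%:~R * y.
    by rewrite /x; case: ifP => _; apply/andP; split; lra.
  exists (x, y) => j Jj; split.
    case/andP: yP => ? ?; case/andP: xP => ? ?.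
    by apply/trap_polygonP; split; lra.
  have [jE|jE|jE|jE] := ord4P j.
  all: move: Jj; rewrite /= jE /trap_conormal /dotp ?(tnth_nth 0) /=.
  all: rewrite ?inordK //=.
  all: rewrite /x /y => Jj.
  + by case: (asboolP (J (inord 3))) => [J3|_]; [case: J03 | ring].
  + by case: (asboolP (J (inord 2))) => [J2|_]; [case: J12 | ring].
  + by rewrite (asboolT Jj); ring.
  + by rewrite (asboolT Jj); ring.
Qed.

(** When both inequalities hold the incidence pattern does not depend on [k]; when one fails, an
    incidence of [k0] is lost or a new one appears. *)
Lemma trap_chamberP {R : realType} (r : int) (k0 k : 'rV[R]_4) :
  0 < r -> 0 < k0 0 (inord 2) + k0 0 (inord 1) ->
  0 < k0 0 (inord 3) - r%:~R * k0 0 (inord 2) + k0 0 ord0 ->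
  chamber (trap_conormal r) k0 k <->
  0 < k 0 (inord 2) + k 0 (inord 1) /\
  0 < k 0 (inord 3) - r%:~R * k 0 (inord 2) + k 0 ord0.
Proof.
move=> r0 h0 s0; rewrite /chamber /analogous /=; split; last first.
  by case=> h s J; rewrite !trap_facets_meet.
move=> A.
have ne1 : inord 1 <> ord0 :> 'I_4 by move=> /(congr1 val); rewrite /= inordK.
have ne3 : inord 3 <> ord0 :> 'I_4 by move=> /(congr1 val); rewrite /= inordK.
have ne12 : inord 1 <> inord 2 :> 'I_4.
  by move=> /(congr1 val); rewrite /= !inordK.
have ne32 : inord 3 <> inord 2 :> 'I_4.
  by move=> /(congr1 val); rewrite /= !inordK.
(* F_1 and F_3 meet at (x, y), which would lie on F_2 if the height vanished,
   and on F_4 if the width of the top edge did. *)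
have [[x y] xy] :
    \bigcap_(j in [set ord0; inord 2]) facet (trap_conormal r) k j !=set0.
  by apply/A/trap_facets_meet => //; split=> /= -[[]? []?]; congruence.
have [/trap_polygonP[x1 y1 y2 x2] /=] := xy ord0 (or_introl erefl).
have [_ /=] := xy (inord 2) (or_intror erefl).
rewrite /dotp /trap_conormal !(tnth_nth 0) /= ?inordK //= => ey ex.
have xE : x = - k 0 ord0 by lra.
have yE : y = k 0 (inord 2) by lra.
subst x y.
have vP : polygon (trap_conormal r) k (- k 0 ord0, k 0 (inord 2)).
  exact/trap_polygonP.
(* Membership of this vertex in the polygon gives both weak inequalities, so only equality has to be
   refuted. *)
rewrite !lt_neqAle; split; apply/andP; split; try lra; apply/eqP => e.
- suff: \bigcap_(j in [set inord 1; inord 2])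
    facet (trap_conormal r) k j !=set0.
    by move/A/trap_facets_meet => -[]// []; split; [left|right].
  exists (- k 0 ord0, k 0 (inord 2)) => j [] ->; split=> //;
    rewrite /dotp /trap_conormal /= ?(tnth_nth 0) /= ?inordK //=; lra.
- suff: \bigcap_(j in [set ord0; inord 3])
    facet (trap_conormal r) k j !=set0.
    by move/A/trap_facets_meet => -[]// _ []; split; [left|right].
  exists (- k 0 ord0, k 0 (inord 2)) => j [] ->; split=> //;
    rewrite /dotp /trap_conormal /= ?(tnth_nth 0) /= ?inordK //=; lra.
Qed.

(** * The mass linearity criterion and the coefficient sum *)

Theorem proposition14 (R : realType) (r : int) (tau lambda : R)
    (hr : 0 < r) (htau : 0 < tau) (hlambda : 0 < lambda)
    (hsigma : 0 < tau - r%:~R * lambda) (b : R * R) :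
  (mass_linear (trap_conormal r) (trap_support lambda tau) b
     <-> r%:~R * b.1 = 2 * b.2) /\
  (mass_linear (trap_conormal r) (trap_support lambda tau) b ->
   forall (c : 'I_4 -> R) (C : R),
     Cm_affine (trap_conormal r) (trap_support lambda tau) b c C ->
     \sum_j c j = 0).
Proof.
have q0 : 0 < r%:~R :> R by rewrite ltr0z.
have chP k : chamber (trap_conormal r) (trap_support lambda tau) k <->
    0 < k 0 (inord 2) + k 0 (inord 1) /\
    0 < k 0 (inord 3) - r%:~R * k 0 (inord 2) + k 0 ord0.
  apply: trap_chamberP => //;
    rewrite !mxE !(tnth_nth 0) /= !inordK //=; lra.
have sum4 (f : 'I_4 -> R) :
    \sum_j f j = f ord0 + f (inord 1) + f (inord 2) + f (inord 3).
  rewrite !big_ord_recl big_ord0 addr0 !addrA.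
  by do !congr (_ + _); congr f; apply/val_inj; rewrite /= ?inordK.
pose K (x1 x2 x3 x4 : R) : 'rV[R]_4 := \row_j tnth [tuple x1; x2; x3; x4] j.
have KE x1 x2 x3 x4 : [/\ K x1 x2 x3 x4 0 ord0 = x1,
    K x1 x2 x3 x4 0 (inord 1) = x2,
    K x1 x2 x3 x4 0 (inord 2) = x3 & K x1 x2 x3 x4 0 (inord 3) = x4].
  by split; rewrite mxE (tnth_nth 0) /= ?inordK.
clearbody K.
have lin_eq : mass_linear (trap_conormal r) (trap_support lambda tau) b ->
    r%:~R * b.1 = 2 * b.2.
  case=> c [C cC].
  (* Support numbers [0, 0, h, 1 + r h] fix the top width at 1; the center of mass identity is
     stated with its denominator [3 * (B + 1)] cleared. *)
  have val (h : R) : 0 < h -> let B := 1 + r%:~R * h in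
    b.1 * (B ^+ 2 + B + 1) + b.2 * (h * (B + 2)) =
    3 * (B + 1) * (c (inord 2) * h + c (inord 3) * B + C).
    move=> h0; have [e1 e2 e3 e4] := KE 0 0 h (1 + r%:~R * h).
    set k := K _ _ _ _ in e1 e2 e3 e4.
    have h1 : 0 < k 0 (inord 2) + k 0 (inord 1).
      by rewrite e2 e3 addr0.
    have s1 : 0 < k 0 (inord 3) -
      r%:~R * k 0 (inord 2) + k 0 ord0.
      by rewrite e1 e3 e4; lra.
    have := cC _ ((chP _).2 (conj h1 s1)).
    rewrite (trap_Cm _ _ hr h1 s1) sum4 e1 e2 e3 e4 /=.
    rewrite !mulr0 !addr0 !add0r !subr0 addrK => <-; field.
    have qh : 0 < r%:~R * h by rewrite mulr_gt0.
    apply/lt0r_neq0; lra.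
  (* Second difference along the segment of trapezia with top width 1 and
     bottom widths 2, 3, 4. *)
  have v1 := val (r%:~R)^-1 ltac:(by rewrite invr_gt0).
  have v2 := val (2 / r%:~R) ltac:(by rewrite divr_gt0).
  have v3 := val (3 / r%:~R) ltac:(by rewrite divr_gt0).
  move: v1 v2 v3 => /=.
  set w : R := r%:~R^-1.
  have qw : r%:~R * w = 1 by rewrite /w mulfV // gt_eqF.
  have -> : r%:~R * (2 * w) = 2 by rewrite mulrCA qw mulr1.
  have -> : r%:~R * (3 * w) = 3 by rewrite mulrCA qw mulr1.
  rewrite qw => v1 v2 v3.
  (* With [t = b.2 * w], the left side divided by [B + 1] is
     [(b.1 + t) * B + (b.1 - 2 * t) / (B + 1)], while the right side becomes affine in [B]. The
     second difference of [1 / (B + 1)] at 2, 3, 4 is 1/30, so [b.1 = 2 * t]. *)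
  have bw : b.1 = 2 * (b.2 * w) by lra.
  by rewrite bw mulrCA (mulrCA _ b.2) qw mulr1.
(* Since [r h = B - s], the two quotients add up to [b.1 * B / 2], where [B = k_4 + r k_2 + k_1];
   the terms in [k_2] then cancel. *)
have Cm_eq k : r%:~R * b.1 = 2 * b.2 ->
    chamber (trap_conormal r) (trap_support lambda tau) k ->
    dotp (Cm (polygon (trap_conormal r) k)) b =
    b.1 / 2 * (k 0 (inord 3) - k 0 ord0).
  move=> eb /chP[h0 s0].
  rewrite (trap_Cm _ _ hr h0 s0) /=.
  have -> : b.2 = r%:~R * b.1 / 2 by rewrite eb; field.
  have qh : 0 < r%:~R * (k 0 (inord 2) + k 0 (inord 1)) by rewrite mulr_gt0.
  by field; apply/lt0r_neq0; lra.
split; first split=> //.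
- move=> eb.
  exists (tnth [tuple - (b.1 / 2); 0; 0; b.1 / 2]), 0 => k kC.
  rewrite Cm_eq // sum4 !(tnth_nth 0) /= !inordK //=; ring.
- move=> /lin_eq eb c C cC.
  (* The two test points differ by [(1, 1, 1, 1)]. Subtracting the affine expressions leaves the sum
     of the [c j], while [k_4 - k_1] is the same at both. *)
  have k1C : chamber (trap_conormal r) (trap_support lambda tau)
    (K 0 0 1 (2 * r%:~R)).
    by apply/chP; have [-> -> -> ->] := KE 0 0 1 (2 * r%:~R); split; lra.
  have k2C : chamber (trap_conormal r) (trap_support lambda tau)
    (K 1 1 2 (2 * r%:~R + 1)).
    by apply/chP; have [-> -> -> ->] := KE 1 1 2 (2 * r%:~R + 1); split; lra.
  have := cC _ k1C; rewrite (Cm_eq _ eb k1C).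
  have := cC _ k2C; rewrite (Cm_eq _ eb k2C) !sum4.
  have [-> -> -> ->] := KE 0 0 1 (2 * r%:~R).
  have [-> -> -> ->] := KE 1 1 2 (2 * r%:~R + 1).
  lra.
Qed.
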